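(* The $L$-theory $T_{\log}$ has a universal axiomatization, i.e. there is a set of universal $L$-sentences whose models are exactly the models of $T_{\log}$.
   Context: Asymptotic couples. An asymptotic couple is a pair $(\Gamma,\psi)$ where $\Gamma$ is a (totally) ordered abelian group and $\psi:\Gamma^{\neq}\to\Gamma$ (with $\Gamma^{\neq}=\Gamma\setminus\{0\}$) satisfies for all $\alpha,\beta\in\Gamma^{\neq}$: (AC1) $\alpha+\beta\neq0\Rightarrow\psi(\alpha+\beta)\geq\min(\psi(\alpha),\psi(\beta))$; (AC2) $\psi(r\alpha)=\psi(\alpha)$ for all nonzero $r\in\mathbb{Z}$; (AC3) $\alpha>0\Rightarrow\alpha+\psi(\alpha)>\psi(\beta)$. It is $H$-asymptotic (of $H$-type) if moreover $0<\alpha\leq\beta\Rightarrow\psi(\alpha)\geq\psi(\beta)$, and divisible if $\Gamma$ is divisible. Put $\Psi=\psi(\Gamma^{\neq})$ and $\gamma'=\gamma+\psi(\gamma)$ for $\gamma\in\Gamma^{\neq}$. $(\Gamma,\psi)$ has asymptotic integration if $\{\gamma':\gamma\in\Gamma^{\neq}\}=\Gamma$; if it is also of $H$-type, then for each $\alpha\in\Gamma$ there is a unique $\beta\in\Gamma^{\neq}$ with $\beta'=\alpha$, denoted $\int\alpha$, and the successor function is $s:\Gamma\to\Psi$, $s(\alpha)=\psi(\int\alpha)$; write $s\alpha=s(\alpha)$, so $s0=s(0)$. The theory $T_{\log}$. Let $L_0=\{0,+,-,<,\psi,\infty\}$. An asymptotic couple is an $L_0$-structure with underlying set $\Gamma_\infty=\Gamma\cup\{\infty\}$,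 $\Gamma<\infty$, and $\infty$ as default value: $-\infty=\gamma+\infty=\infty+\gamma=\infty+\infty=\psi(0)=\psi(\infty)=\infty$. $T_0$ is the $L_0$-theory whose models are the divisible $H$-asymptotic couples with asymptotic integration such that: $\Psi$ has a least element, equal to $s0$, and $s0>0$; every $\alpha\in\Psi$ has an immediate successor in the ordered set $\Psi$, namely $s\alpha$; and $\gamma\mapsto s\gamma:\Psi\to\Psi^{>s0}=\{x\in\Psi:x>s0\}$ is a bijection. For a model of $T_0$ let $p:\Psi^{>s0}\to\Psi$ be the inverse of this bijection, extended to $\Gamma_\infty$ by $p(\alpha)=\infty$ for $\alpha\in\Gamma_\infty\setminus\Psi^{>s0}$. Let $L=L_0\cup\{s,p,\delta_1,\delta_2,\dots\}$ with all new symbols unary function symbols; models of $T_0$ are construed as $L$-structures with $s$ interpreted as the successor function $\alpha\mapsto\psi(\int\alpha)$ on $\Gamma$ and $s(\infty)=\infty$, $p$ interpreted as the function $p:\Gamma_\infty\to\Gamma_\infty$ that inverts $\gamma\mapsto s\gamma:\Psi\to\Psi^{>s0}$ on $\Psi^{>s0}$ and takes the value $\infty$ elsewhere, and $\delta_n$ interpreted as division by $n$ ($\delta_n(\infty)=\infty$). $T_{\log}$ is the $L$-theory whose models are the models of $T_0$ so construed. *)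

(* Defs.v *)
From HB Require Import structures.
From mathcomp Require Import all_boot all_order all_algebra.
From mathcomp Require Import boolp classical_sets functions.

Set Implicit Arguments.
Unset Strict Implicit.
Unset Printing Implicit Defensive.

Import Order.TTheory GRing.Theory Num.Theory.

Local Open Scope classical_set_scope.
Local Open Scope ring_scope.

(** * First-order logic *)

Record language := Language {
  fsym : Type;
  farity : fsym -> nat;
  rsym : Type;
  rarity : rsym -> nat
}.

Inductive term (L : language) : Type :=
| TVar of nat
| TApp (f : fsym L) of ('I_(farity f) -> term L).
Arguments TVar {L}.

Inductive formula (L : language) : Type :=
| FEq of term L & term L
| FRel (r : rsym L) of ('I_(rarity r) -> term L)
| FNot of formula L
| FAnd of formula L & formula L
| FOr of formula L & formula L
| FImp of formula L & formula L
| FAll of nat & formula L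
| FEx of nat & formula L.

Record structure (L : language) := Structure {
  carrier :> Type;
  finterp : forall f : fsym L, ('I_(farity f) -> carrier) -> carrier;
  rinterp : forall r : rsym L, ('I_(rarity r) -> carrier) -> Prop
}.

Fixpoint eval (L : language) (M : structure L) (e : nat -> M) (t : term L)
    : M :=
  match t with
  | TVar x => e x
  | TApp f a => finterp (fun i => eval e (a i))
  end.

Definition update (T : Type) (e : nat -> T) (x : nat) (m : T) : nat -> T :=
  fun y => if y == x then m else e y.

Fixpoint sat (L : language) (M : structure L) (e : nat -> M) (phi : formula L)
    : Prop :=
  match phi with
  | FEq t u => eval e t = eval e u
  | FRel r a => rinterp (fun i => eval e (a i))
  | FNot p => ~ sat e p
  | FAnd p q => sat e p /\ sat e q
  | FOr p q => sat e p \/ sat e q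
  | FImp p q => sat e p -> sat e q
  | FAll x p => forall m : M, sat (update e x m) p
  | FEx x p => exists m : M, sat (update e x m) p
  end.

Fixpoint occurs (L : language) (x : nat) (t : term L) : Prop :=
  match t with
  | TVar y => x = y
  | TApp _ a => exists i, occurs x (a i)
  end.

Fixpoint free_in (L : language) (x : nat) (phi : formula L) : Prop :=
  match phi with
  | FEq t u => occurs x t \/ occurs x u
  | FRel _ a => exists i, occurs x (a i)
  | FNot p => free_in x p
  | FAnd p q | FOr p q | FImp p q => free_in x p \/ free_in x q
  | FAll y p | FEx y p => x <> y /\ free_in x p
  end.

Definition sentence (L : language) (phi : formula L) : Prop :=
  forall x, ~ free_in x phi.

Fixpoint quantifier_free (L : language) (phi : formula L) : Prop :=
  match phi with
  | FEq _ _ | FRel _ _ => True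
  | FNot p => quantifier_free p
  | FAnd p q | FOr p q | FImp p q => quantifier_free p /\ quantifier_free q
  | FAll _ _ | FEx _ _ => False
  end.

Definition universal_sentence (L : language) (phi : formula L) : Prop :=
  sentence phi /\
  exists (xs : seq nat) (theta : formula L),
    quantifier_free theta /\ phi = foldr (@FAll L) theta xs.

(* For a sentence, satisfaction does not depend on the assignment. *)
Definition models (L : language) (M : structure L) (Sigma : set (formula L))
    : Prop :=
  forall phi, Sigma phi -> forall e : nat -> M, sat e phi.

Definition isomorphic (L : language) (M N : structure L) : Prop :=
  exists h : M -> N,
    [/\ bijective h,
        forall (f : fsym L) (a : 'I_(farity f) -> M),
          h (finterp a) = finterp (fun i => h (a i))
      & forall (r : rsym L) (a : 'I_(rarity r) -> M),
          rinterp a <-> rinterp (fun i => h (a i))].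

(** * Asymptotic couples *)

Definition ordered_abelian_group (G : porderZmodType) : Prop :=
  total (<=%R : rel G) /\
  (forall x y z : G, x <= y -> x + z <= y + z).

Definition divisible (G : porderZmodType) : Prop :=
  forall (n : nat) (a : G), (0 < n)%N -> exists b : G, b *+ n = a.

Section AsymptoticCouples.
(* Only the values of [psi] at nonzero arguments matter. *)
Variables (G : porderZmodType) (psi : G -> G).

Definition asymptotic_couple : Prop :=
  [/\ ordered_abelian_group G,
      forall a b : G, a != 0 -> b != 0 -> a + b != 0 ->
        Order.min (psi a) (psi b) <= psi (a + b),
      forall (r : int) (a : G), r != 0 -> a != 0 -> psi (a *~ r) = psi a
    & forall a b : G, a != 0 -> b != 0 -> 0 < a -> psi b < a + psi a].

Definition H_type : Prop :=
  forall a b : G, 0 < a -> a <= b -> psi b <= psi a.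

Definition Psi : set G := psi @` [set g | g != 0].

Definition derivative (g : G) : G := g + psi g.

Definition asymptotic_integration : Prop :=
  derivative @` [set g | g != 0] = setT.

Definition integral (a : G) : G :=
  xget 0 [set b | b != 0 /\ derivative b = a].

Definition successor (a : G) : G := psi (integral a).

Definition Psi_gt_s0 : set G := [set x | Psi x /\ successor 0 < x].

Definition T0_couple : Prop :=
  [/\ asymptotic_couple, H_type, divisible G & asymptotic_integration] /\
  [/\ Psi (successor 0) /\ (forall x, Psi x -> successor 0 <= x),
      0 < successor 0,
      forall a, Psi a ->
        [/\ Psi (successor a), a < successor a
          & ~ exists b, [/\ Psi b, a < b & b < successor a]]
    & set_bij Psi Psi_gt_s0 successor].

Definition predecessor (a : G) : option G :=
  if `[< Psi_gt_s0 a >] then Some (xget 0 [set g | Psi g /\ successor g = a])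
  else None.

Definition divn_by (n : nat) (a : G) : G := xget 0 [set b | b *+ n = a].

End AsymptoticCouples.

(** * The language L and the theory T_log *)

(* [SDelta n] is the symbol delta_(n+1), for n >= 0. *)
Inductive Lfun := SZero | SAdd | SOpp | SPsi | SInfty | SSucc | SPred
  | SDelta of nat.

Inductive Lrel := SLt.

Definition Lfun_arity (f : Lfun) : nat :=
  match f with
  | SZero | SInfty => 0
  | SAdd => 2
  | SOpp | SPsi | SSucc | SPred | SDelta _ => 1
  end.

Definition Lrel_arity (r : Lrel) : nat := 2.

Definition Llog : language := Language Lfun_arity Lrel_arity.

Section LogStructure.
(* Gamma_infty is [option G], with [None] as infinity. *)
Variables (G : porderZmodType) (psi : G -> G).

Definition add_infty (x y : option G) : option G :=
  match x, y with
  | Some a, Some b => Some (a + b)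
  | _, _ => None
  end.

Definition lt_infty (x y : option G) : Prop :=
  match x, y with
  | Some a, Some b => a < b
  | Some _, None => True
  | None, _ => False
  end.

Definition psi_infty (x : option G) : option G :=
  match x with
  | Some a => if a == 0 then None else Some (psi a)
  | None => None
  end.

Definition log_finterp (f : Lfun)
    : ('I_(Lfun_arity f) -> option G) -> option G :=
  match f return ('I_(Lfun_arity f) -> option G) -> option G with
  | SZero => fun _ => Some 0
  | SAdd => fun a => add_infty (a ord0) (a ord_max)
  | SOpp => fun a => omap -%R (a ord0)
  | SPsi => fun a => psi_infty (a ord0)
  | SInfty => fun _ => None
  | SSucc => fun a => omap (successor psi) (a ord0)
  | SPred => fun a => obind (predecessor psi) (a ord0)
  | SDelta n => fun a => omap (divn_by n.+1) (a ord0)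
  end.

Definition log_rinterp (r : Lrel) (a : 'I_(Lrel_arity r) -> option G) : Prop :=
  lt_infty (a ord0) (a ord_max).

Definition log_structure : structure Llog :=
  @Structure Llog (option G) log_finterp log_rinterp.

End LogStructure.

(* Up to isomorphism, as the class of models of a theory is. *)
Definition Tlog_model (M : structure Llog) : Prop :=
  exists (G : porderZmodType) (psi : G -> G),
    T0_couple psi /\ isomorphic (log_structure psi) M.

(* Main.v *)
(* Integration costs no quantifier, since the integral of [a] is [a - s a], and
   neither does division, thanks to the symbols delta_n.  The only other
   existential content of T_0 is that [p a] lies in Psi when it is finite:
   either [p a = s 0], or [p a] is in the domain of [p] and
   [p a = s (p (p a))], and all values of [s] lie in Psi.  Hence T_log is
   axiomatized by the universal closures of quantifier-free formulas.
   Conversely, on the finite elements of a model of these, [psi] makes an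
   asymptotic couple, the derivation [g + psi g] is strictly increasing, hence
   injective, and so [s], [p] and the divisions are the intended functions. *)

From HB Require Import structures.
From mathcomp Require Import all_boot all_order all_algebra.
From mathcomp Require Import boolp classical_sets functions.
Require Import Defs.

Set Implicit Arguments.
Unset Strict Implicit.
Unset Printing Implicit Defensive.

Import Order.TTheory GRing.Theory Num.Theory.

Local Open Scope classical_set_scope.
Local Open Scope ring_scope.

(** * Universal closures *)

Section UniversalClosure.
Variable L : language.

Fixpoint term_bound (t : term L) : nat :=
  match t with
  | TVar x => x.+1
  | TApp f a => \max_(i < farity f) term_bound (a i)
  end.

Fixpoint formula_bound (phi : formula L) : nat :=
  match phi with
  | FEq t u => maxn (term_bound t) (term_bound u)
  | FRel r a => \max_(i < rarity r) term_bound (a i)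
  | FNot p => formula_bound p
  | FAnd p q | FOr p q | FImp p q => maxn (formula_bound p) (formula_bound q)
  | FAll _ p | FEx _ p => formula_bound p
  end.

Lemma occurs_lt_bound x (t : term L) : occurs x t -> (x < term_bound t)%N.
Proof.
elim: t => [y <- //|f a IH] /= [i /IH /leq_trans]; apply.
exact: leq_bigmax.
Qed.

Lemma free_in_lt_bound x (phi : formula L) :
  free_in x phi -> (x < formula_bound phi)%N.
Proof.
elim: phi => [t u|r a|p IH|p IHp q IHq|p IHp q IHq|p IHp q IHq|y p IH|y p IH]
  /=; rewrite ?leq_max.
- by case=> /occurs_lt_bound ->; rewrite ?orbT.
- by case=> i /occurs_lt_bound /leq_trans; apply; exact: leq_bigmax.
- by [].
- by case=> [/IHp|/IHq] ->; rewrite ?orbT.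
- by case=> [/IHp|/IHq] ->; rewrite ?orbT.
- by case=> [/IHp|/IHq] ->; rewrite ?orbT.
- by case=> _ /IH.
- by case=> _ /IH.
Qed.

(** The prefix runs over all indices below the bound, hence over every free variable; the remaining
    quantifiers are vacuous. *)
Definition universal_closure (phi : formula L) : formula L :=
  foldr (@FAll L) phi (iota 0 (formula_bound phi)).

Lemma free_in_foldr_FAll x xs (phi : formula L) :
  free_in x (foldr (@FAll L) phi xs) -> x \notin xs /\ free_in x phi.
Proof.
elim: xs => [|y xs IH] //= [/eqP xy] /IH[xxs fx].
by rewrite inE negb_or xy.
Qed.

Lemma universal_closure_universal (phi : formula L) :
  quantifier_free phi -> universal_sentence (universal_closure phi).
Proof.
move=> qf; split; last by exists (iota 0 (formula_bound phi)), phi.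
move=> x /free_in_foldr_FAll[] + /free_in_lt_bound.
by rewrite mem_iota /= add0n => /negPf ->.
Qed.

Lemma update_id (T : Type) (e : nat -> T) x : update e x (e x) = e.
Proof. by apply/funext => y; rewrite /update; case: eqP => [->|]. Qed.

(** Ranging over all assignments absorbs the universal quantifiers of the prefix one at a time. *)
Lemma sat_universal_closure (M : structure L) (phi : formula L) :
  (forall e : nat -> M, sat e (universal_closure phi)) <->
  (forall e : nat -> M, sat e phi).
Proof.
rewrite /universal_closure; elim: (iota _ _) => [//|x xs IH] /=.
split=> [sat_all|sat_phi e m]; last by apply: (IH.2 sat_phi).
(* Instantiating the outermost quantifier at the current value [e x] gives back the assignment
   [e]. *)
by apply: IH.1 => e; have := sat_all e (e x); rewrite update_id.
Qed.

End UniversalClosure.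

(** * Invariance of satisfaction under isomorphism *)

Section IsomorphismInvariance.
Variables (L : language) (M N : structure L) (h : M -> N).
Hypothesis h_bij : bijective h.
Hypothesis h_fun : forall (f : fsym L) (a : 'I_(farity f) -> M),
  h (finterp a) = finterp (fun i => h (a i)).
Hypothesis h_rel : forall (r : rsym L) (a : 'I_(rarity r) -> M),
  rinterp a <-> rinterp (fun i => h (a i)).

Lemma eval_iso (e : nat -> M) t : eval (h \o e) t = h (eval e t).
Proof.
by elim: t => [//|f a IH] /=; rewrite h_fun; congr finterp; apply/funext.
Qed.

Lemma update_iso (e : nat -> M) x m :
  h \o update e x m = update (h \o e) x (h m).
Proof. by apply/funext => y; rewrite /update /=; case: eqP. Qed.

(** Injectivity of [h] serves the equations, surjectivity the quantifiers: each element of [N] is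
    the image of one of [M], and updating an assignment commutes with [h]. *)
Lemma sat_iso (e : nat -> M) phi : sat (h \o e) phi <-> sat e phi.
Proof.
have [g hK gK] := h_bij.
elim: phi e => [t u|r a|p IH|p IHp q IHq|p IHp q IHq|p IHp q IHq|x p IH|x p IH]
  e /=.
- by rewrite !eval_iso; split=> [/(bij_inj h_bij)|->].
- rewrite h_rel; under eq_fun do rewrite eval_iso.
  by [].
- by rewrite IH.
- by rewrite IHp IHq.
- by rewrite IHp IHq.
- by rewrite IHp IHq.
- split=> H m; first by rewrite -IH update_iso; exact: H.
  by rewrite -[m]gK -update_iso IH.
- split=> -[m H].
    by exists (g m); rewrite -IH update_iso gK.
  by exists (h m); rewrite -update_iso IH.
Qed.

End IsomorphismInvariance.

(** * Asymptotic couples *)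

Section OrderedAbelianGroup.
Variable G : porderZmodType.
Hypothesis oG : ordered_abelian_group G.

Lemma oag_leVlt (x y : G) : x <= y \/ y < x.
Proof.
have /orP[xy|] := oG.1 x y; first by left.
by rewrite le_eqVlt => /orP[/eqP->|]; [left|right].
Qed.

Lemma oag_ltVlt (x y : G) : [\/ x < y, x = y | y < x].
Proof.
have [|] := oag_leVlt x y; last by constructor 3.
by rewrite le_eqVlt => /orP[/eqP->|]; [constructor 2|constructor 1].
Qed.

Lemma oag_leD2r (z x y : G) : x <= y -> x + z <= y + z.
Proof. exact: oG.2. Qed.

Lemma oag_ltD2r (z x y : G) : x < y -> x + z < y + z.
Proof.
rewrite !lt_def => /andP[yx /oag_leD2r->]; rewrite andbT.
by rewrite (inj_eq (addIr z)).
Qed.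

Lemma oag_ltD (x y u v : G) : x < y -> u <= v -> x + u < y + v.
Proof.
move=> xy uv; apply: lt_le_trans (oag_ltD2r u xy) _.
by rewrite ![y + _]addrC oag_leD2r.
Qed.

Lemma oag_mulrn_gt0 (x : G) n : 0 < x -> 0 < x *+ n.+1.
Proof.
move=> x0; elim: n => [//|n IH].
by rewrite mulrS -[ltLHS](addr0 0) oag_ltD // ltW.
Qed.

(** Ordered groups are torsion-free: if [u < v], then [v - u] is positive and so are its multiples,
    whereas equal multiples of [u] and [v] make one of them zero. *)
Lemma oag_mulrIn n : injective (fun x : G => x *+ n.+1).
Proof.
have pos (u v : G) : u *+ n.+1 = v *+ n.+1 -> ~ u < v.
  move=> uv /(oag_ltD2r (- u)); rewrite subrr => /(@oag_mulrn_gt0 _ n).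
  by rewrite mulrnBl uv subrr ltxx.
by move=> x y xy; case: (oag_ltVlt x y) => // /pos; case.
Qed.

Lemma divn_byK n (a : G) : divisible G -> divn_by n.+1 a *+ n.+1 = a.
Proof.
move=> /(_ n.+1 a isT)[b ba].
exact: (@xgetPex _ 0 [set b | b *+ n.+1 = a] (ex_intro _ b ba)).
Qed.

(** Torsion-freeness leaves a single quotient, so the choice made by [divn_by] must return [b]. *)
Lemma divn_byE n (a b : G) : b *+ n.+1 = a -> divn_by n.+1 a = b.
Proof.
move=> ba; apply: (@oag_mulrIn n); rewrite /= ba.
exact: (@xgetPex _ 0 [set b | b *+ n.+1 = a] (ex_intro _ b ba)).
Qed.

End OrderedAbelianGroup.

(** * Monotonicity of the derivation and uniqueness of integrals *)

Section AsymptoticCouple.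
Variables (G : porderZmodType) (psi : G -> G).
Hypothesis ac : asymptotic_couple psi.

Let oG : ordered_abelian_group G. Proof. by case: ac. Qed.

Lemma asymptotic_couple_psiN (a : G) : a != 0 -> psi (- a) = psi a.
Proof.
by case: ac => _ _ /(_ (-1) a isT) + _ => /[apply]; rewrite mulrN1z.
Qed.

(* If [psi b < psi a] then [psi (b - a) = psi b], as for any valuation, and
   (AC3) applied to [b - a > 0] and [a] is the claim. *)
Lemma derivative_lt (a b : G) : a != 0 -> b != 0 -> a < b ->
  derivative psi a < derivative psi b.
Proof.
move=> a0 b0 ab; have [ba|ab'] := oag_leVlt oG (psi a) (psi b).
  exact: oag_ltD.
have ba0 : b - a != 0 by rewrite subr_eq0 gt_eqF.
have ba_gt0 : 0 < b - a by rewrite -(subrr a) oag_ltD2r.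
have [_ ac1 _ ac3] := ac.
have psi_ba : psi (b - a) <= psi b.
  have := ac1 (b - a) a ba0 a0; rewrite subrK => /(_ b0).
  by rewrite /Order.min; case: ifP => // _ /(lt_le_trans ab'); rewrite ltxx.
have : psi a < b - a + psi b.
  apply: lt_le_trans (ac3 _ _ ba0 a0 ba_gt0) _.
  by rewrite ![b - a + _]addrC oag_leD2r.
by move=> /(oag_ltD2r oG a); rewrite addrAC subrK [psi a + a]addrC.
Qed.

Lemma derivative_inj (a b : G) : a != 0 -> b != 0 ->
  derivative psi a = derivative psi b -> a = b.
Proof.
move=> a0 b0 ab; case: (oag_ltVlt oG a b) => // /derivative_lt.
  by rewrite ab ltxx => /(_ a0 b0).
by rewrite ab ltxx => /(_ b0 a0).
Qed.

(** Since the derivation is injective, the choice in [integral] can only return [b]. One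
    antiderivative of [a] thus determines [s a], even before asymptotic integration is
    established. *)
Lemma successorE (a b : G) : b != 0 -> derivative psi b = a ->
  successor psi a = psi b.
Proof.
move=> b0 ba; rewrite /successor /integral.
have [] := @xgetPex _ 0 [set b | b != 0 /\ derivative psi b = a]
  (ex_intro _ b (conj b0 ba)).
by set c := xget _ _ => c0; rewrite -ba => /(derivative_inj c0 b0) ->.
Qed.

End AsymptoticCouple.

(** * Integral, successor and predecessor in models of T_0 *)

Section T0Couple.
Variables (G : porderZmodType) (psi : G -> G).
Hypothesis T0 : T0_couple psi.

Let ac : asymptotic_couple psi. Proof. by case: T0 => [[]]. Qed.

Local Notation s := (successor psi).
Local Notation s0 := (s 0).

Lemma integralP (a : G) :
  integral psi a != 0 /\ derivative psi (integral psi a) = a.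
Proof.
have [[_ _ _ ai] _] := T0.
have [b b0 ba] : (derivative psi @` [set g | g != 0]) a by rewrite ai.
exact: (@xgetPex _ 0 [set b | b != 0 /\ derivative psi b = a]
  (ex_intro _ b (conj b0 ba))).
Qed.

(** If [b] is the integral of [a], then [b + psi b = a], and [psi b] is [s a] by definition. This
    makes the integral a term of the language. *)
Lemma integralE (a : G) : integral psi a = a - s a.
Proof. by apply/eqP; rewrite eq_sym subr_eq -[X in X == _](integralP a).2. Qed.

Lemma sub_successor_neq0 (a : G) : a - s a != 0.
Proof. by rewrite -integralE (integralP a).1. Qed.

Lemma psi_sub_successor (a : G) : psi (a - s a) = s a.
Proof. by rewrite -integralE. Qed.

Lemma psi_Psi (a : G) : a != 0 -> Psi psi (psi a).
Proof. by move=> a0; exists a. Qed.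

(** The choice in [predecessor] returns [g] because [s] is injective on Psi. *)
Lemma predecessor_successor (g : G) :
  Psi psi g -> predecessor psi (s g) = Some g.
Proof.
have [_ [_ _ _ [s_fun s_inj _]]] := T0.
move=> Pg; rewrite /predecessor; case: asboolP => [_|/(_ (s_fun _ Pg))//].
have [] := @xgetPex _ 0 [set g' | Psi psi g' /\ s g' = s g]
  (ex_intro _ g (conj Pg erefl)).
by set c := xget _ _ => Pc sc; congr Some; apply: s_inj; rewrite ?inE.
Qed.

Lemma successor_surj (a : G) : Psi psi a -> s0 < a ->
  exists2 g, Psi psi g & a = s g.
Proof.
have [_ [_ _ _ [_ _ s_surj]]] := T0.
by move=> Pa sa; have [g Pg <-] := s_surj a (conj Pa sa); exists g.
Qed.

Lemma predecessorP (a g : G) : predecessor psi a = Some g ->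
  [/\ s0 < a, Psi psi g & a = s g].
Proof.
have [[Pa sa]|nPa] := pselect (Psi_gt_s0 psi a).
  have [h Ph ah] := successor_surj Pa sa.
  by rewrite {1}ah predecessor_successor // => -[<-].
by rewrite /predecessor; case: asboolP.
Qed.

(** An element of Psi other than the least one lies above [s 0], hence in the domain of [p]. This is
    what [ax_pred_Psi] expresses about [p a]. *)
Lemma Psi_s0_or_successor (g : G) : Psi psi g ->
  g = s0 \/ exists2 h, predecessor psi g = Some h & g = s h.
Proof.
have [_ [[_ s0_least] _ _ _]] := T0.
move=> Pg; have := s0_least g Pg; rewrite le_eqVlt => /orP[/eqP<-|].
  by left.
move=> /(successor_surj Pg)[h Ph ->]; right; exists h => //.
exact: predecessor_successor.
Qed.

End T0Couple.

(** * The axioms *)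

Definition args0 (T : Type) (i : 'I_0) : T :=
  False_rect T (notF (ltn_ord i)).
Definition args1 (T : Type) (x : T) (i : 'I_1) : T := x.
Definition args2 (T : Type) (x y : T) (i : 'I_2) : T :=
  if i == ord0 then x else y.

(** These three normal forms, which hold by extensionality, let the symbols of an arbitrary
    structure be treated as curried operations. *)
Lemma args0E (T : Type) (a : 'I_0 -> T) : a = @args0 T.
Proof. by apply/funext => -[]. Qed.

Lemma args1E (T : Type) (a : 'I_1 -> T) : a = args1 (a ord0).
Proof. by apply/funext => i; rewrite (ord1 i). Qed.

Lemma args2E (T : Type) (a : 'I_2 -> T) : a = args2 (a ord0) (a ord_max).
Proof.
apply/funext => i; rewrite /args2; case: eqP => [->//|i0].
by congr a; case: i i0 => -[|[|//]] lt_i i0; apply/val_inj => //; case: i0;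
  apply/val_inj.
Qed.

Section Terms.
Implicit Types t u : term Llog.

Definition tzero : term Llog := TApp (L := Llog) (f := SZero) (@args0 _).
Definition tinf : term Llog := TApp (L := Llog) (f := SInfty) (@args0 _).
Definition tadd t u : term Llog := TApp (L := Llog) (f := SAdd) (args2 t u).
Definition topp t : term Llog := TApp (L := Llog) (f := SOpp) (args1 t).
Definition tpsi t : term Llog := TApp (L := Llog) (f := SPsi) (args1 t).
Definition tsucc t : term Llog := TApp (L := Llog) (f := SSucc) (args1 t).
Definition tpred t : term Llog := TApp (L := Llog) (f := SPred) (args1 t).
Definition tdelta n t : term Llog := TApp (L := Llog) (f := SDelta n) (args1 t).
Definition flt t u : formula Llog := FRel (L := Llog) (r := SLt) (args2 t u).
Definition tmuln t n : term Llog := iterop n tadd t tzero.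

End Terms.

Section Operations.
Variable M : structure Llog.
Implicit Types x y : M.

Definition mzero : M := finterp (L := Llog) (f := SZero) (@args0 _).
Definition minf : M := finterp (L := Llog) (f := SInfty) (@args0 _).
Definition madd x y : M := finterp (L := Llog) (f := SAdd) (args2 x y).
Definition mopp x : M := finterp (L := Llog) (f := SOpp) (args1 x).
Definition mpsi x : M := finterp (L := Llog) (f := SPsi) (args1 x).
Definition msucc x : M := finterp (L := Llog) (f := SSucc) (args1 x).
Definition mpred x : M := finterp (L := Llog) (f := SPred) (args1 x).
Definition mdelta n x : M := finterp (L := Llog) (f := SDelta n) (args1 x).
Definition mlt x y : Prop := rinterp (L := Llog) (r := SLt) (args2 x y).
Definition mmuln x n : M := iterop n madd x mzero.

Variable e : nat -> M.

Lemma eval_args2 t u :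
  (fun i => eval e (args2 t u i)) = args2 (eval e t) (eval e u).
Proof. by apply/funext => i; rewrite /args2; case: ifP. Qed.

Lemma eval_tzero : eval e tzero = mzero.
Proof. by congr finterp; exact: args0E. Qed.

Lemma eval_tinf : eval e tinf = minf.
Proof. by congr finterp; exact: args0E. Qed.

Lemma eval_tadd t u : eval e (tadd t u) = madd (eval e t) (eval e u).
Proof. by congr finterp; exact: eval_args2. Qed.

Lemma eval_tmuln t n : eval e (tmuln t n) = mmuln (eval e t) n.
Proof.
rewrite /tmuln /mmuln; case: n => [|n]; first exact: eval_tzero.
by rewrite !iteropS; elim: n => [//|n IH]; rewrite !iterS eval_tadd IH.
Qed.

Lemma sat_flt t u : sat e (flt t u) = mlt (eval e t) (eval e u).
Proof. by rewrite /mlt -eval_args2. Qed.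

(** Together with [satE], these rules turn satisfaction of an axiom into a statement about the
    curried operations of [M]. *)
Definition evalE :=
  (eval_tzero, eval_tinf, eval_tadd, eval_tmuln, sat_flt,
   fun t => erefl : eval e (topp t) = mopp (eval e t),
   fun t => erefl : eval e (tpsi t) = mpsi (eval e t),
   fun t => erefl : eval e (tsucc t) = msucc (eval e t),
   fun t => erefl : eval e (tpred t) = mpred (eval e t),
   fun n t => erefl : eval e (tdelta n t) = mdelta n (eval e t)).

End Operations.

Arguments mzero {M}.
Arguments minf {M}.

Section SatE.
Variables (M : structure Llog) (e : nat -> M).

Definition satE :=
  (fun t u => erefl : sat e (FEq t u) = (eval e t = eval e u),
   fun p => erefl : sat e (FNot p) = ~ sat e p,
   fun p q => erefl : sat e (FAnd p q) = (sat e p /\ sat e q),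
   fun p q => erefl : sat e (FOr p q) = (sat e p \/ sat e q),
   fun p q => erefl : sat e (FImp p q) = (sat e p -> sat e q),
   fun n => erefl : eval e (TVar n) = e n).

End SatE.

Declare Scope log_scope.
Delimit Scope log_scope with log.
Notation "0" := tzero : log_scope.
Notation "t + u" := (tadd t u) : log_scope.
Notation "- t" := (topp t) : log_scope.
Notation "t - u" := (tadd t (topp u)) : log_scope.
Notation "t *+ n" := (tmuln t n) : log_scope.
Notation "t = u" := (FEq t u) : log_scope.
Notation "t <> u" := (FNot (FEq t u)) : log_scope.
Notation "t < u" := (flt t u) : log_scope.
Notation "~ p" := (FNot p) : log_scope.
Notation "p /\ q" := (FAnd p q) : log_scope.
Notation "p \/ q" := (FOr p q) : log_scope.
Notation "p -> q" := (FImp p q) : log_scope.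

Section LogAxioms.
Local Notation oo := tinf.
Local Notation x := (TVar (L := Llog) 0).
Local Notation y := (TVar (L := Llog) 1).
Local Notation z := (TVar (L := Llog) 2).

(* Variables also range over [oo].  A formula without finiteness hypotheses
   holds there because of the default values, notably [psi 0 = psi oo = oo];
   this is also why (AC1) needs no case distinction, and why (AC3) and (H)
   must exclude [y = oo]. *)
Inductive log_axiom : formula Llog -> Prop :=
| ax_inf_add : log_axiom (oo + x = oo)%log
| ax_inf_opp : log_axiom (- oo = oo)%log
| ax_psi0 : log_axiom (tpsi 0 = oo)%log
| ax_inf_psi : log_axiom (tpsi oo = oo)%log
| ax_inf_succ : log_axiom (tsucc oo = oo)%log
| ax_inf_pred : log_axiom (tpred oo = oo)%log
| ax_inf_delta n : log_axiom (tdelta n oo = oo)%log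
| ax_fin_zero : log_axiom (0 <> oo)%log
| ax_fin_psi : log_axiom (x <> 0 -> x <> oo -> tpsi x <> oo)%log
| ax_fin_succ : log_axiom (x <> oo -> tsucc x <> oo)%log
| ax_addA : log_axiom (x + (y + z) = x + y + z)%log
| ax_addC : log_axiom (x + y = y + x)%log
| ax_add0 : log_axiom (0 + x = x)%log
| ax_addN : log_axiom (x <> oo -> x - x = 0)%log
| ax_lt_irr : log_axiom (~ x < x)%log
| ax_lt_trans : log_axiom (x < y -> y < z -> x < z)%log
| ax_lt_total : log_axiom (x < y \/ x = y \/ y < x)%log
| ax_lt_inf : log_axiom (x <> oo -> x < oo)%log
| ax_lt_add : log_axiom (z <> oo -> x < y -> x + z < y + z)%log
| ax_delta n : log_axiom (tdelta n x *+ n.+1 = x)%log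
| ax_AC1 : log_axiom (~ (tpsi (x + y) < tpsi x /\ tpsi (x + y) < tpsi y))%log
| ax_AC2_opp : log_axiom (tpsi (- x) = tpsi x)%log
| ax_AC2_muln n : log_axiom (tpsi (x *+ n.+1) = tpsi x)%log
| ax_AC3 : log_axiom (0 < x -> y <> 0 -> y <> oo -> tpsi y < x + tpsi x)%log
| ax_H : log_axiom (y <> oo -> 0 < x -> x < y -> ~ tpsi x < tpsi y)%log
| ax_integration : log_axiom (x <> oo -> tpsi (x - tsucc x) = tsucc x)%log
| ax_s0_least : log_axiom (~ tpsi x < tsucc 0)%log
| ax_s0_gt0 : log_axiom (0 < tsucc 0)%log
| ax_succ_gt : log_axiom (x <> 0 -> x <> oo -> tpsi x < tsucc (tpsi x))%log
| ax_succ_next : log_axiom (~ (tpsi x < tpsi y /\ tpsi y < tsucc (tpsi x)))%log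
| ax_pred_dom : log_axiom (tsucc 0 < tpsi x -> tpsi x <> oo ->
    tpred (tpsi x) <> oo)%log
| ax_pred : log_axiom (tpred x <> oo ->
    tsucc 0 < x /\ tsucc (tpred x) = x)%log
| ax_pred_Psi : log_axiom (tpred x <> oo ->
    tpred x = tsucc 0 \/ tpred x = tsucc (tpred (tpred x)))%log.

End LogAxioms.

Lemma log_axiom_qf phi : log_axiom phi -> quantifier_free phi.
Proof. by case. Qed.

(** * Every model of T_log satisfies the axioms *)

Section LogStructure.
Variables (G : porderZmodType) (psi : G -> G).
Notation M := (log_structure psi).

Definition log_structureE :=
  (erefl : @mzero M = Some 0,
   erefl : @minf M = None,
   fun a b => erefl : @madd M a b = add_infty a b,
   fun a => erefl : @mopp M a = omap -%R a,
   fun a => erefl : @mpsi M a = psi_infty psi a,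
   fun a => erefl : @msucc M a = omap (successor psi) a,
   fun a => erefl : @mpred M a = obind (predecessor psi) a,
   fun n a => erefl : @mdelta M n a = omap (divn_by n.+1) a,
   fun a b => erefl : @mlt M a b = lt_infty a b).

(** The multiplier is positive because the zeroth multiple of infinity is 0, not infinity. *)
Lemma log_structure_muln (a : option G) n :
  @mmuln M a n.+1 = omap (fun b => b *+ n.+1) a.
Proof.
rewrite /mmuln iteropS; elim: n => [|n IH]; first by case: a.
by rewrite iterS IH log_structureE; case: a {IH} => //= b; rewrite [RHS]mulrS.
Qed.

Lemma psi_infty_neq0 (a : G) : a != 0 -> psi_infty psi (Some a) = Some (psi a).
Proof. by rewrite /= => /negPf ->. Qed.

Lemma Some_neq0 (a : G) : Some a <> Some 0 -> a != 0.
Proof. by move=> a0; apply/eqP => aE; apply: a0; rewrite aE. Qed.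

Hypothesis T0 : T0_couple psi.

Lemma log_structure_log_axiom phi : log_axiom phi ->
  forall e : nat -> log_structure psi, sat e phi.
Proof.
have [[ac H_psi div _] [[_ s0_least] s0_gt0 s_next _]] := T0.
have [oG ac1 ac2 ac3] := ac.
have psi_fin a : Some a <> Some 0 -> psi_infty psi (Some a) = Some (psi a).
  by move=> /Some_neq0; exact: psi_infty_neq0.
(* Axioms that hold by computation or by a hypothesis in context vanish here; the others remain in
   the order of the constructors. *)
case=> [||||||n|||||||||||||n|||n||||||||||] e;
  rewrite !(satE, evalE) ?log_structure_muln !log_structureE //;
  move: (e 0) (e 1) (e 2) => x y z //=.
- by rewrite eqxx.
- by case: x => // a; rewrite -/(psi_infty psi (Some a)) => /psi_fin ->.
- by case: x.
- by case: x => [a|]; case: y => [b|]; case: z => [c|] //=; rewrite addrA.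
- by case: x => [a|]; case: y => [b|] //=; rewrite addrC.
- by case: x => [a|] //=; rewrite add0r.
- by case: x => [a|] //=; rewrite subrr.
- by case: x => [a|] //=; rewrite ltxx.
- by case: x => [a|]; case: y => [b|]; case: z => [c|] //=; exact: lt_trans.
- case: x => [a|]; case: y => [b|] /=; try by tauto.
  by case: (oag_ltVlt oG a b) => [|->|]; tauto.
- by case: x.
- by case: x => [a|]; case: y => [b|]; case: z => [c|] //= _; exact: oag_ltD2r.
- by case: x => [a|] //=; rewrite divn_byK.
- case: x => [a|]; case: y => [b|] /=; try by tauto.
  (* If a summand is 0, one of the two inequalities compares a value with itself; if the sum is 0,
     its value is infinity, which lies below nothing. Otherwise (AC1) applies. *)
  have [->|a0] := eqVneq a 0.
    by rewrite add0r => -[_]; case: eqVneq => //= _; rewrite ltxx.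
  have [->|b0] := eqVneq b 0.
    by rewrite addr0 (negPf a0) /= ltxx => -[].
  have [_ [] //|ab0] := eqVneq (a + b) 0.
  move=> /= -[aba abb]; have := ac1 a b a0 b0 ab0.
  by rewrite /Order.min; case: ifP => _ /le_lt_trans;
    [move/(_ _ aba)|move/(_ _ abb)]; rewrite ltxx.
- case: x => [a|] //=; rewrite oppr_eq0; case: eqVneq => // a0.
  by rewrite (asymptotic_couple_psiN ac).
- case: x => [a|] //=; have [->|a0] := eqVneq a 0; first by rewrite mul0rn eqxx.
  (* By torsion-freeness a positive multiple of a nonzero element is nonzero, so [psi_infty] is
     finite there and (AC2) applies with a positive integer. *)
  rewrite ifF; first by rewrite -[a *+ _]/(a *~ n.+1) ac2.
  apply: contra_neqF a0 => /eqP an; apply: (@oag_mulrIn _ oG n).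
  by rewrite an mul0rn.
(* For [x] infinite the right-hand side is infinity, and finiteness of [psi y] suffices. *)
- case: x => [a|]; case: y => [b|] //=; last by move=> _ /psi_fin /= ->.
  move=> a0 /[dup] /Some_neq0 b0 /psi_fin /= -> _.
  by rewrite gt_eqF //= ac3 // gt_eqF.
- case: x => [a|]; case: y => [b|] //= _ a0.
  move=> ab; rewrite (gt_eqF a0) (gt_eqF (lt_trans a0 ab)) /=.
  by rewrite (le_gtF (H_psi _ _ a0 (ltW ab))).
- case: x => [a|] //= _.
  by rewrite (negPf (sub_successor_neq0 T0 a)) psi_sub_successor.
- case: x => [a|] //=; case: eqVneq => [_ []|a0] //=.
  by rewrite le_gtF // s0_least //; exact: psi_Psi.
- case: x => [a|] //=; case: eqVneq => [-> []//|a0 _ _] /=.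
  by case: (s_next _ (psi_Psi psi a0)).
- case: x => [a|]; case: y => [b|] //=; try by tauto.
    case: eqVneq => //= [_ []//|a0]; case: eqVneq => //= [_ []//|b0] [ab bs].
    case: (s_next _ (psi_Psi psi a0)) => _ _; apply; exists (psi b); split=> //.
    exact: psi_Psi.
- case: x => [a|] //=; case: eqVneq => //= a0 sa _.
  have [g Pg ->] := successor_surj T0 (psi_Psi psi a0) sa.
  by rewrite predecessor_successor.
- case: x => [a|] //=; case pa: predecessor => [g|] //= _.
  by have [? _ <-] := predecessorP T0 pa.
- case: x => [a|] //=; case pa: predecessor => [g|] //= _.
  have [_ Pg _] := predecessorP T0 pa.
  have [->|[h -> ->]] := Psi_s0_or_successor T0 Pg; first by left.
  by right.
Qed.
End LogStructure.

Lemma Tlog_model_log_axiom (M : structure Llog) phi : Tlog_model M ->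
  log_axiom phi -> forall e : nat -> M, sat e phi.
Proof.
move=> [G [psi [T0 [h [h_bij h_fun h_rel]]]]] ax e.
have [g hK gK] := h_bij.
(* Every assignment in [M] is the image of one in the isomorphic log structure. *)
have -> : e = h \o (g \o e) by apply/funext => n /=; rewrite gK.
by apply/sat_iso => //; exact: log_structure_log_axiom.
Qed.

(** * The asymptotic couple of a model of the axioms *)

Section Completeness.
Variable M : structure Llog.
Hypothesis M_ax : forall phi, log_axiom phi -> forall e : nat -> M, sat e phi.

Implicit Types x y z : M.

(** As the carrier of [M] is an arbitrary type, finiteness is made boolean classically, and so are
    the equality and choice structures obtained. *)
Definition fin_elt : Type := {x : M | `[< x <> minf >]}.

HB.instance Definition _ := SubType.copy fin_elt {x : M | `[< x <> minf >]}.
HB.instance Definition _ := gen_eqMixin fin_elt.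
HB.instance Definition _ := gen_choiceMixin fin_elt.

Implicit Types a b c : fin_elt.

(** The axioms use only the variables 0, 1 and 2, so three values give all the instances
    required. *)
Let ax3 phi (ax : log_axiom phi) x y z :
  sat (fun n => match n with 0 => x | 1 => y | _ => z end) phi.
Proof. exact: M_ax. Qed.

Let add_infl x : madd minf x = minf.
Proof. by have := ax3 ax_inf_add x x x; rewrite !(satE, evalE). Qed.

Let mzero_fin : @mzero M <> minf.
Proof. by have := ax3 ax_fin_zero minf minf minf; rewrite !(satE, evalE). Qed.

Let maddA x y z : madd x (madd y z) = madd (madd x y) z.
Proof. by have := ax3 ax_addA x y z; rewrite !(satE, evalE). Qed.

Let maddC x y : madd x y = madd y x.
Proof. by have := ax3 ax_addC x y x; rewrite !(satE, evalE). Qed.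

Let madd0 x : madd mzero x = x.
Proof. by have := ax3 ax_add0 x x x; rewrite !(satE, evalE). Qed.

Let maddN x : x <> minf -> madd x (mopp x) = mzero.
Proof. by have := ax3 ax_addN x x x; rewrite !(satE, evalE). Qed.

Let mlt_irr x : ~ mlt x x.
Proof. by have := ax3 ax_lt_irr x x x; rewrite !(satE, evalE). Qed.

Let mlt_trans x y z : mlt x y -> mlt y z -> mlt x z.
Proof. by have := ax3 ax_lt_trans x y z; rewrite !(satE, evalE). Qed.

Let mlt_total x y : mlt x y \/ x = y \/ mlt y x.
Proof. by have := ax3 ax_lt_total x y x; rewrite !(satE, evalE). Qed.

Let mlt_inf x : x <> minf -> mlt x minf.
Proof. by have := ax3 ax_lt_inf x x x; rewrite !(satE, evalE). Qed.

Let mlt_add x y z : z <> minf -> mlt x y -> mlt (madd x z) (madd y z).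
Proof. by have := ax3 ax_lt_add x y z; rewrite !(satE, evalE). Qed.

Let mpsi_fin x : x <> mzero -> x <> minf -> mpsi x <> minf.
Proof. by have := ax3 ax_fin_psi x x x; rewrite !(satE, evalE). Qed.

Let msucc_fin x : x <> minf -> msucc x <> minf.
Proof. by have := ax3 ax_fin_succ x x x; rewrite !(satE, evalE). Qed.

Let mpsi0 : @mpsi M mzero = minf.
Proof. by have := ax3 ax_psi0 minf minf minf; rewrite !(satE, evalE). Qed.

Let msucc_inf : @msucc M minf = minf.
Proof. by have := ax3 ax_inf_succ minf minf minf; rewrite !(satE, evalE). Qed.

Let mopp_inf : @mopp M minf = minf.
Proof. by have := ax3 ax_inf_opp minf minf minf; rewrite !(satE, evalE). Qed.

Let mpsi_inf : @mpsi M minf = minf.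
Proof. by have := ax3 ax_inf_psi minf minf minf; rewrite !(satE, evalE). Qed.

Let mpred_inf : @mpred M minf = minf.
Proof. by have := ax3 ax_inf_pred minf minf minf; rewrite !(satE, evalE). Qed.

Let mdelta_inf n : @mdelta M n minf = minf.
Proof.
by have := ax3 (ax_inf_delta n) minf minf minf; rewrite !(satE, evalE).
Qed.

Let mmuln_inf n : @mmuln M minf n.+1 = minf.
Proof. by rewrite /mmuln iteropS; elim: n => [//|n IH]; rewrite iterS IH. Qed.

Let mdeltaK n x : mmuln (mdelta n x) n.+1 = x.
Proof. by have := ax3 (ax_delta n) x x x; rewrite !(satE, evalE). Qed.

Let mpsi_add x y :
  ~ (mlt (mpsi (madd x y)) (mpsi x) /\ mlt (mpsi (madd x y)) (mpsi y)).
Proof. by have := ax3 ax_AC1 x y x; rewrite !(satE, evalE). Qed.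

Let mpsi_opp x : mpsi (mopp x) = mpsi x.
Proof. by have := ax3 ax_AC2_opp x x x; rewrite !(satE, evalE). Qed.

Let mpsi_muln n x : mpsi (mmuln x n.+1) = mpsi x.
Proof. by have := ax3 (ax_AC2_muln n) x x x; rewrite !(satE, evalE). Qed.

Let mpsi_lt x y : mlt mzero x -> y <> mzero -> y <> minf ->
  mlt (mpsi y) (madd x (mpsi x)).
Proof. by have := ax3 ax_AC3 x y x; rewrite !(satE, evalE). Qed.

Let mpsi_H x y : y <> minf -> mlt mzero x -> mlt x y -> ~ mlt (mpsi x) (mpsi y).
Proof. by have := ax3 ax_H x y x; rewrite !(satE, evalE). Qed.

Let mpsi_integral x : x <> minf -> mpsi (madd x (mopp (msucc x))) = msucc x.
Proof. by have := ax3 ax_integration x x x; rewrite !(satE, evalE). Qed.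

Let ms0_least x : ~ mlt (mpsi x) (msucc mzero).
Proof. by have := ax3 ax_s0_least x x x; rewrite !(satE, evalE). Qed.

Let ms0_gt0 : @mlt M mzero (msucc mzero).
Proof. by have := ax3 ax_s0_gt0 minf minf minf; rewrite !(satE, evalE). Qed.

Let msucc_gt x : x <> mzero -> x <> minf -> mlt (mpsi x) (msucc (mpsi x)).
Proof. by have := ax3 ax_succ_gt x x x; rewrite !(satE, evalE). Qed.

Let msucc_next x y :
  ~ (mlt (mpsi x) (mpsi y) /\ mlt (mpsi y) (msucc (mpsi x))).
Proof. by have := ax3 ax_succ_next x y x; rewrite !(satE, evalE). Qed.

Let mpred_dom x : mlt (msucc mzero) (mpsi x) -> mpsi x <> minf ->
  mpred (mpsi x) <> minf.
Proof. by have := ax3 ax_pred_dom x x x; rewrite !(satE, evalE). Qed.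

Let mpredK x : mpred x <> minf -> mlt (msucc mzero) x /\ msucc (mpred x) = x.
Proof. by have := ax3 ax_pred x x x; rewrite !(satE, evalE). Qed.

Let mpred_Psi x : mpred x <> minf ->
  mpred x = msucc mzero \/ mpred x = msucc (mpred (mpred x)).
Proof. by have := ax3 ax_pred_Psi x x x; rewrite !(satE, evalE). Qed.

(** * The ordered abelian group of finite elements *)

Let madd_fin x y : x <> minf -> y <> minf -> madd x y <> minf.
Proof.
move=> xf yf xy; apply: xf.
(* Since [y] is finite, [x = x + (y - y) = (x + y) - y], which would be infinity if [x + y] were. *)
by rewrite -[x]madd0 maddC -(maddN yf) maddA xy add_infl.
Qed.

Let mopp_fin x : x <> minf -> mopp x <> minf.
Proof.
by move=> xf Nx; apply: mzero_fin; rewrite -(maddN xf) Nx maddC add_infl.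
Qed.

(* Junk value: [fine minf] is the zero of [fin_elt]. *)
Definition fine x : fin_elt := insubd (exist _ mzero (asboolT mzero_fin)) x.

Let val_fin a : val a <> minf.
Proof. exact/asboolP/(valP a). Qed.

Let fineK x : x <> minf -> val (fine x) = x.
Proof. by move=> xf; rewrite val_insubd asboolT. Qed.

Fact fin_addA : associative (fun a b => fine (madd (val a) (val b))).
Proof.
move=> a b c; apply/val_inj; rewrite !fineK ?maddA //;
  repeat apply: madd_fin; exact: val_fin.
Qed.

Fact fin_addC : commutative (fun a b => fine (madd (val a) (val b))).
Proof. by move=> a b; rewrite maddC. Qed.

Fact fin_add0 : left_id (fine mzero) (fun a b => fine (madd (val a) (val b))).
Proof. by move=> a; apply/val_inj; rewrite (fineK mzero_fin) madd0 fineK. Qed.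

Fact fin_addN :
  left_inverse (fine mzero) (fun a => fine (mopp (val a)))
    (fun a b => fine (madd (val a) (val b))).
Proof.
move=> a; rewrite fineK ?[madd _ (val a)]maddC ?maddN //.
exact/mopp_fin/val_fin.
Qed.

HB.instance Definition _ :=
  GRing.isZmodule.Build fin_elt fin_addA fin_addC fin_add0 fin_addN.

Fact fin_lt_irr : irreflexive (fun a b => `[< mlt (val a) (val b) >]).
Proof. by move=> a; apply/asboolP/mlt_irr. Qed.

Fact fin_lt_trans : transitive (fun a b => `[< mlt (val a) (val b) >]).
Proof.
by move=> b a c /asboolP ab /asboolP bc; apply/asboolP; exact: mlt_trans bc.
Qed.

HB.instance Definition _ :=
  Order.Lt_isPOrder.Build ring_display fin_elt fin_lt_irr fin_lt_trans.

(** This map becomes the isomorphism of the log structure onto [M]. *)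
Let oval (a : option fin_elt) : M := oapp val minf a.

Let val0 : val (0 : fin_elt) = mzero.
Proof. exact: fineK. Qed.

Let valD a b : val (a + b) = madd (val a) (val b).
Proof. exact/fineK/madd_fin. Qed.

Let valN a : val (- a) = mopp (val a).
Proof. exact/fineK/mopp_fin. Qed.

Let valMn a n : val (a *+ n.+1) = mmuln (val a) n.+1.
Proof.
rewrite /mmuln iteropS; elim: n => [//|n IH].
by rewrite iterS -IH -valD mulrS.
Qed.

Let ltE a b : a < b <-> mlt (val a) (val b).
Proof. by split=> [/asboolP|/asboolP]. Qed.

Let neq0 a : a != 0 <-> val a <> mzero.
Proof.
rewrite -val0; split=> [/eqP a0 /val_inj //|a0].
by apply/eqP => aE; rewrite aE in a0.
Qed.

Let val_neq0 a : a != 0 -> val a <> mzero. Proof. by move/neq0. Qed.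

(** At 0 this is a junk value, because [mpsi mzero] is infinity; hence the condition [a != 0] in
    [val_psi]. *)
Definition fin_psi a : fin_elt := fine (mpsi (val a)).

Let val_psi a : a != 0 -> val (fin_psi a) = mpsi (val a).
Proof. by move=> /neq0 a0; exact/fineK/mpsi_fin. Qed.

Let val_succ a : val (fine (msucc (val a))) = msucc (val a).
Proof. exact/fineK/msucc_fin. Qed.

Fact fin_ordered : ordered_abelian_group fin_elt.
Proof.
split=> [a b|a b c].
  rewrite !le_eqVlt.
  have [/ltE->|[/val_inj->|/ltE->]] := mlt_total (val a) (val b);
    by rewrite ?eqxx ?orbT.
rewrite !le_eqVlt => /orP[/eqP->|/ltE ab]; first by rewrite eqxx.
by apply/orP; right; apply/ltE; rewrite !valD; exact: mlt_add.
Qed.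

Let ltNge a b : ~ a < b -> b <= a.
Proof. by case: (oag_leVlt fin_ordered b a). Qed.

(** * The finite elements form a model of T_0 *)

Fact fin_asymptotic_couple : asymptotic_couple fin_psi.
Proof.
split; first exact: fin_ordered.
- move=> a b a0 b0 ab0; have ac1 := @mpsi_add (val a) (val b).
  rewrite -valD -!val_psi // -!ltE in ac1.
  (* The axiom says that [psi (a + b)] is not below both values; in a total order it is then at
     least the smaller one. *)
  rewrite /Order.min; case: ifP => [ab|/negP/ltNge ba];
    apply: ltNge => abp; apply: ac1; split=> //.
    exact: lt_trans ab.
  exact: lt_le_trans ba.
- have psiMn n a : fin_psi (a *+ n.+1) = fin_psi a.
    by rewrite /fin_psi valMn mpsi_muln.
  have psiN a : fin_psi (- a) = fin_psi a by rewrite /fin_psi valN mpsi_opp.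
  (* A nonzero integer is [n.+1] or its opposite, so the axioms on positive multiples and on
     opposites cover (AC2). *)
  by case=> [[//|n]|n] a _ a0; rewrite ?NegzE ?mulrNz ?psiN psiMn.
- move=> a b a0 /[dup] b0 /val_neq0 b0' /ltE; rewrite val0 => a_gt0; apply/ltE.
  by rewrite valD !val_psi //; exact: mpsi_lt.
Qed.

(** The integration axiom gives [psi (a - s a) = s a], which is finite while [psi 0] is not; so
    [a - s a] is nonzero, and its derivative is [(a - s a) + s a = a]. *)
Let succE a : successor fin_psi a = fine (msucc (val a)).
Proof.
have psi_int := mpsi_integral (@val_fin a).
rewrite -val_succ -valN -valD in psi_int.
have int_neq0 : a - fine (msucc (val a)) != 0.
  apply/neq0 => int0; apply: (@val_fin (fine (msucc (val a)))).
  by rewrite -psi_int int0 mpsi0.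
have psi_intE : fin_psi (a - fine (msucc (val a))) = fine (msucc (val a)).
  by apply/val_inj; rewrite val_psi.
rewrite -[RHS]psi_intE.
apply: successorE => //; first exact: fin_asymptotic_couple.
by rewrite /derivative psi_intE subrK.
Qed.

Let val_successor a : val (successor fin_psi a) = msucc (val a).
Proof. by rewrite succE. Qed.

Let int_neq0 a : a - successor fin_psi a != 0.
Proof.
apply/neq0; rewrite valD valN val_successor => int0.
apply: (msucc_fin (@val_fin a)).
by rewrite -mpsi_integral // int0 mpsi0.
Qed.

Let psi_int a : fin_psi (a - successor fin_psi a) = successor fin_psi a.
Proof.
apply/val_inj; rewrite val_psi ?int_neq0 //.
by rewrite valD valN val_successor mpsi_integral.
Qed.

Let succ_Psi a : Psi fin_psi (successor fin_psi a).
Proof.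
by exists (a - successor fin_psi a); [exact: int_neq0|exact: psi_int].
Qed.

Let succ_gt a : Psi fin_psi a -> a < successor fin_psi a.
Proof.
move=> [b b0 <-]; apply/ltE; rewrite val_successor val_psi //.
by apply: msucc_gt => //; exact: val_neq0.
Qed.

Let succ_next a b : Psi fin_psi a -> Psi fin_psi b ->
  ~ (a < b /\ b < successor fin_psi a).
Proof.
by move=> [c c0 <-] [d d0 <-]; rewrite !ltE val_successor !val_psi.
Qed.

Let s0_least a : Psi fin_psi a -> successor fin_psi 0 <= a.
Proof.
move=> [b b0 <-]; apply: ltNge; rewrite ltE val_psi // val_successor val0.
exact: ms0_least.
Qed.

(** Membership in Psi comes from [ax_pred_Psi]: in both of its cases [p a] is a value of [s] at a
    finite element, and all such values lie in Psi. *)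
Let predP a : mpred (val a) <> minf ->
  [/\ successor fin_psi 0 < a, Psi fin_psi (fine (mpred (val a)))
    & successor fin_psi (fine (mpred (val a))) = a].
Proof.
move=> pf; have [s0a spa] := mpredK pf; split.
- by apply/ltE; rewrite val_successor val0.
- have [ps0|pss] := mpred_Psi pf.
    by rewrite ps0 -val0 -succE; exact: succ_Psi.
  (* Were [p (p a)] infinite, [p a = s (p (p a))] would be infinite as well. *)
  have ppf : mpred (mpred (val a)) <> minf.
    by move=> ppa; apply: pf; rewrite pss ppa.
  by rewrite pss -(fineK ppf) -succE; exact: succ_Psi.
- by apply/val_inj; rewrite val_successor fineK.
Qed.

Let pred_dom a : Psi fin_psi a -> successor fin_psi 0 < a ->
  mpred (val a) <> minf.
Proof.
move=> [b b0 <-] /ltE; rewrite val_successor val0 val_psi // => s0b.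
by apply: mpred_dom => //; apply: mpsi_fin => //; exact: val_neq0.
Qed.

Fact fin_T0_couple : T0_couple fin_psi.
Proof.
split; split.
- exact: fin_asymptotic_couple.
- move=> a b a_gt0; rewrite le_eqVlt => /orP[/eqP->//|ab].
  apply: ltNge => /ltE; rewrite !val_psi ?gt_eqF ?(lt_trans a_gt0 ab) //.
  by apply: mpsi_H; rewrite -?val0 -?ltE.
- move=> [//|n] a _; exists (fine (mdelta n (val a))).
  apply/val_inj; rewrite valMn fineK // => dinf.
  (* The quotient is finite because positive multiples of infinity are infinite. *)
  by apply: (@val_fin a); rewrite -(mdeltaK n (val a)) dinf mmuln_inf.
- apply/seteqP; split=> // a _.
  exists (a - successor fin_psi a); first exact: int_neq0.
  by rewrite /derivative psi_int subrK.
- by split; [exact: succ_Psi|exact: s0_least].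
- by apply/ltE; rewrite val_successor val0.
- move=> a Pa; split; [exact: succ_Psi|exact: succ_gt|].
  by move=> [b [Pb ab bs]]; case: (@succ_next a b).
- split.
  + move=> a Pa; split; first exact: succ_Psi.
    exact: le_lt_trans (s0_least Pa) (succ_gt Pa).
  (* Injectivity follows from immediacy of successors: if [a < b] in Psi and [s a = s b], then [b]
     lies strictly between [a] and [s a]. *)
  + have s_mono a b : Psi fin_psi a -> Psi fin_psi b ->
        successor fin_psi a = successor fin_psi b -> ~ a < b.
      move=> Pa Pb sab ab; apply: (succ_next Pa Pb).
      by rewrite sab; split=> //; exact: succ_gt.
    move=> a b /set_mem Pa /set_mem Pb sab.
    have [ab|//|ba] := oag_ltVlt fin_ordered a b; first by case: (s_mono a b).
    by case: (s_mono b a).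
  + move=> a [Pa s0a]; have [_ Pp sp] := predP (pred_dom Pa s0a).
    by exists (fine (mpred (val a))).
Qed.

(** * The isomorphism with the given model *)

Let oval_predecessor a : oval (predecessor fin_psi a) = mpred (val a).
Proof.
(* The two predecessors have the same domain: [pred_dom] excludes that only [p] of [M] is infinite,
   and [predP] gives the converse. Where finite, both invert [s] on Psi. *)
have [p_inf|pf] := pselect (mpred (val a) = minf).
  case pa: predecessor => [g|]; last by rewrite p_inf.
  have [s0a Pg aE] := predecessorP fin_T0_couple pa.
  by case: (@pred_dom a) => //; rewrite aE; exact: succ_Psi.
have [_ Pp {1}<-] := predP pf.
by rewrite (predecessor_successor fin_T0_couple Pp) /oval /= fineK.
Qed.

Let oval_divn n a : val (divn_by n.+1 a) = mdelta n (val a).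
Proof.
have df : mdelta n (val a) <> minf.
  move=> dinf; apply: (@val_fin a).
  by rewrite -(mdeltaK n (val a)) dinf mmuln_inf.
rewrite -[RHS](fineK df); congr val; apply: (divn_byE fin_ordered).
by apply/val_inj; rewrite valMn fineK.
Qed.

Fact oval_isomorphic : isomorphic (log_structure fin_psi) M.
Proof.
exists oval; split.
(* The inverse sends finite elements to themselves and [minf] to [None]. *)
- exists insub.
    by case=> [a|]; rewrite /= ?valK // insubN //; apply/asboolP.
  by move=> x; case: insubP => [a _ <-//|/asboolP/contrapT ->].
- case=> [||||||| n] a.
  + by rewrite [X in _ = finterp X]args0E; exact: val0.
  + rewrite [X in _ = finterp X]args2E.
    change (oval (add_infty (a ord0) (a ord_max)) =
      madd (oval (a ord0)) (oval (a ord_max))).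
    case: (a ord0) (a ord_max) => [b|] [c|];
      [exact: valD| |exact/esym/add_infl..].
    by rewrite maddC add_infl.
  + rewrite [X in _ = finterp X]args1E.
    change (oval (omap -%R (a ord0)) = mopp (oval (a ord0))).
    by case: (a ord0) => [b|]; [exact: valN|rewrite mopp_inf].
  + rewrite [X in _ = finterp X]args1E.
    change (oval (psi_infty fin_psi (a ord0)) = mpsi (oval (a ord0))).
    case: (a ord0) => [b|]; last by rewrite mpsi_inf.
    (* At 0 the junk value of [fin_psi] is hidden by [psi_infty], and both sides are infinite. *)
    have [->|b0] := eqVneq b 0; last by rewrite psi_infty_neq0 // [LHS]val_psi.
    by rewrite /psi_infty eqxx [oval (Some 0)]val0 mpsi0.
  + by rewrite [X in _ = finterp X]args0E.
  + rewrite [X in _ = finterp X]args1E.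
    change (oval (omap (successor fin_psi) (a ord0)) = msucc (oval (a ord0))).
    by case: (a ord0) => [b|]; [exact: val_successor|rewrite msucc_inf].
  + rewrite [X in _ = finterp X]args1E.
    change (oval (obind (predecessor fin_psi) (a ord0)) =
      mpred (oval (a ord0))).
    by case: (a ord0) => [b|]; [exact: oval_predecessor|rewrite mpred_inf].
  + rewrite [X in _ = finterp X]args1E.
    change (oval (omap (divn_by n.+1) (a ord0)) = mdelta n (oval (a ord0))).
    by case: (a ord0) => [b|]; [exact: oval_divn|rewrite mdelta_inf].
- case=> a; rewrite [X in _ <-> rinterp X]args2E.
  change (lt_infty (a ord0) (a ord_max) <->
    mlt (oval (a ord0)) (oval (a ord_max))).
  case: (a ord0) (a ord_max) => [b|] [c|]; first exact: ltE.
  + by split=> // _; exact/mlt_inf/val_fin.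
  (* Infinity below a finite element would, by transitivity, be below itself. *)
  + by split=> // cb; case: (mlt_irr (mlt_trans cb (mlt_inf (@val_fin c)))).
  + by split=> // cb; case: (mlt_irr cb).
Qed.

Lemma log_axiom_Tlog_model : Tlog_model M.
Proof.
exists fin_elt, fin_psi.
by split; [exact: fin_T0_couple|exact: oval_isomorphic].
Qed.

End Completeness.

Theorem lemma5p1 :
  exists Sigma : set (formula Llog),
    (forall phi : formula Llog, Sigma phi -> universal_sentence phi) /\
    (forall M : structure Llog, models M Sigma <-> Tlog_model M).
Proof.
exists [set universal_closure phi | phi in log_axiom]; split.
  by move=> _ [phi ax <-]; exact/universal_closure_universal/log_axiom_qf.
move=> M; split=> [M_ax|M_model _ [phi ax <-]].
  apply: log_axiom_Tlog_model => phi ax.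
  by apply/sat_universal_closure; apply: M_ax; exists phi.
by apply/sat_universal_closure; exact: Tlog_model_log_axiom.
Qed.
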